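(* Let $\Delta \in \mathbb{N}_0$, let $\delta > 0$ and suppose that $x,y \in \mathbb{C}^L$ are $B$-bandlimited, for some $B \in \mathbb{N}_0$. Let $G_\delta = (V_\delta, E)$ be the essential support graph of $x$ with time separation parameter $\Delta$ and assume that the subgraph of $G_\delta$ induced by the vertex set $S_\delta = V_\delta \cap \operatorname{supp} y$ has $K$ connected components whose vertex sets are denoted by $\{S_k\}_{k=1}^K$. If $\phi \in \mathbb{C}^L$ is such that $$\min_{\substack{m \in \{0,\dots,\Delta+1\}\\ n \in \{-2B,\dots,2B\}}} \lvert \mathcal{A}[\phi](m,n) \rvert \geq \frac{1}{c}$$ for some $c > 0$, then $$\inf_{\alpha_1,\dots,\alpha_K \in \mathbb{R}} \sum_{k=1}^K \left\lVert x - \mathrm{e}^{\mathrm{i}\alpha_k} y \right\rVert_{\ell^2(S_k)} \leq \frac{c\sqrt{K}}{\delta}\left(1 + 2\sqrt{\frac{L+\Delta}{2+\Delta}}\, \frac{\lVert x \rVert_{\ell^2(S_\delta)}}{\delta}\right) \left\lVert M_\phi[x] - M_\phi[y] \right\rVert_{\mathrm{F}}.$$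
   Context: Fix $L \in \mathbb{N}$. Vectors in $\mathbb{C}^L$ are indexed by $\{0,\dots,L-1\}$, and all indexing (of vectors and of $L\times L$ arrays) is periodic modulo $L$, e.g. $\phi(\ell) = \phi(\ell \bmod L)$ for $\ell \in \mathbb{Z}$. The support is $\operatorname{supp} x = \{\ell \in \{0,\dots,L-1\} : x(\ell) \neq 0\}$. The discrete Fourier transform (DFT) is $\mathcal{F}[x](k) = \frac{1}{\sqrt{L}}\sum_{\ell=0}^{L-1} x(\ell)\mathrm{e}^{-2\pi\mathrm{i}\ell k/L}$. The discrete Gabor transform of $x \in \mathbb{C}^L$ with window $\phi \in \mathbb{C}^L$ is $\mathcal{V}_\phi[x](m,n) = \frac{1}{\sqrt{L}} \sum_{\ell=0}^{L-1} x(\ell)\overline{\phi(\ell-m)}\mathrm{e}^{-2\pi\mathrm{i}\ell n/L}$, $m,n = 0,\dots,L-1$. The ambiguity function is $\mathcal{A}[x] := \mathcal{V}_x[x]$, and the measurements are $M_\phi[x](m,n) := \lvert \mathcal{V}_\phi[x](m,n)\rvert^2$, $m,n=0,\dots,L-1$. $\lVert\cdot\rVert_{\mathrm{F}}$ is the Frobenius norm of $L\times L$ matrices. For $B \in \mathbb{N}_0$, $x \in \mathbb{C}^L$ is $B$-bandlimited if $\operatorname{supp} \mathcal{F}[x] \subset \{-B,\dots,B\} \bmod L$. For $S \subset \{0,\dots,L-1\}$, $\lVert x \rVert_{\ell^2(S)} = \left(\sum_{\ell \in S} \lvert x(\ell)\rvert^2\right)^{1/2}$. For $\Delta \in \mathbb{N}_0$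 and $\delta > 0$, the essential support graph of $x$ with time separation parameter $\Delta$ is the graph $G_\delta = (V_\delta,E)$ with vertex set $V_\delta = \{\ell \in \{0,\dots,L-1\} : \lvert x(\ell)\rvert \geq \delta\}$ and an edge between $\ell,k \in V_\delta$ if $\lvert \ell-k\rvert \in (0,\Delta+1] \cup [L-\Delta-1,L)$. *)

(* Defs.v *)
From HB Require Import structures.
From mathcomp Require Import all_boot all_order all_algebra.
From mathcomp Require Import all_classical all_reals all_analysis.
From mathcomp Require Import complex.
Set Implicit Arguments.
Unset Strict Implicit.
Unset Printing Implicit Defensive.
Import Order.TTheory GRing.Theory Num.Theory.
Local Open Scope ring_scope.

Notation modulus := Normc.normc.

Definition expi (R : realType) (t : R) : R[i] := Complex (cos t) (sin t).

(* [Some] of the representative of [z] modulo [L] as soon as [0 < L]; the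
   [None] branch, hence the default value 0 used below, only occurs for
   [L = 0]. *)
Definition residue (L : nat) (z : int) : option 'I_L := insub `|(z %% L%:Z)%Z|%N.

Definition perV (R : realType) (L : nat) (x : 'cV[R[i]]_L) (z : int) : R[i] :=
  if residue L z is Some l then x l 0 else 0.

Definition perM (R : realType) (L : nat) (A : 'M[R[i]]_L) (m n : int) : R[i] :=
  if residue L m is Some i then
    if residue L n is Some j then A i j else 0
  else 0.

Lemma residue_ord (L : nat) (l : 'I_L) (q : int) :
  residue L (q * L%:Z + l%:Z) = Some l.
Proof.
have L0 : (0 < L)%N by apply: leq_trans (ltn_ord l).
rewrite /residue modzMDl modz_nat absz_nat modn_small //.
by rewrite -[X in insub X]/(val l) valK.
Qed.

Definition supp (R : realType) (L : nat) (x : 'cV[R[i]]_L) : {set 'I_L} :=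
  [set l | x l 0 != 0].

Definition dft (R : realType) (L : nat) (x : 'cV[R[i]]_L) : 'cV[R[i]]_L :=
  \col_(k < L) (((Num.sqrt L%:R)^-1 : R)%:C%C *
    \sum_(l < L) x l 0 * expi (- (2 * pi * l%:R * k%:R / L%:R))).

Definition gabor (R : realType) (L : nat) (phi x : 'cV[R[i]]_L) : 'M[R[i]]_L :=
  \matrix_(m < L, n < L) (((Num.sqrt L%:R)^-1 : R)%:C%C *
    \sum_(l < L) x l 0 * (perV phi (l%:Z - m%:Z))^* *
                 expi (- (2 * pi * l%:R * n%:R / L%:R))).

Definition ambiguity (R : realType) (L : nat) (x : 'cV[R[i]]_L) : 'M[R[i]]_L :=
  gabor x x.

Definition measurement (R : realType) (L : nat) (phi x : 'cV[R[i]]_L) :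
    'M[R]_L :=
  \matrix_(m < L, n < L) modulus (gabor phi x m n) ^+ 2.

Definition frobenius (R : realType) (m n : nat) (A : 'M[R]_(m, n)) : R :=
  Num.sqrt (\sum_i \sum_j `|A i j| ^+ 2).

Definition bandlimited (R : realType) (L B : nat) (x : 'cV[R[i]]_L) : Prop :=
  forall k : 'I_L, k \in supp (dft x) ->
    exists2 j : int, - B%:Z <= j <= B%:Z & (k%:Z = j %[mod L%:Z])%Z.

Definition l2norm (R : realType) (L : nat) (S : {set 'I_L})
    (x : 'cV[R[i]]_L) : R :=
  Num.sqrt (\sum_(l in S) modulus (x l 0) ^+ 2).

Definition ess_supp (R : realType) (L : nat) (delta : R) (x : 'cV[R[i]]_L) :
    {set 'I_L} :=
  [set l | delta <= modulus (x l 0)].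

(* For [L <= Delta + 1] the second interval contains 0 and so allows loops;
   these do not affect connected components. *)
Definition ess_edge (R : realType) (L Delta : nat) (delta : R)
    (x : 'cV[R[i]]_L) : rel 'I_L :=
  [rel l k | [&& l \in ess_supp delta x, k \in ess_supp delta x &
     (0 < `|l%:Z - k%:Z| <= Delta%:Z + 1)
     || (L%:Z - Delta%:Z - 1 <= `|l%:Z - k%:Z| < L%:Z)]].

Definition induced (T : finType) (e : rel T) (S : {set T}) : rel T :=
  [rel u v | [&& u \in S, v \in S & e u v]].

Definition components (T : finType) (e : rel T) (S : {set T}) :
    {set {set T}} :=
  equivalence_partition (connect (induced e S)) S.

(* Main.v *)
(* The two-dimensional Fourier transform of |V_phi[x]|^2 is, up to normalization
   and a reflection, A[x] times the conjugate of A[phi].  Hence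
   ||M[x] - M[y]||_F^2 = sum |A[x] - A[y]|^2 |A[phi]|^2, and since A[x] and A[y]
   only live at the frequencies -2B..2B, the lower bound on A[phi] controls
   sum |x(l) x(k)^* - y(l) y(k)^*|^2 over all ordered pairs (l, k) at cyclic
   distance at most Delta + 1.  The pairs l = k control |x| - |y|; the pairs
   l <> k control the variation of the relative phase of x and y along edges.
   A shortest path between two vertices of a component has no chord, so its
   even-numbered vertices are pairwise at least Delta + 2 apart and it has at most
   2 (L + Delta) / (2 + Delta) edges; as both orientations of each edge occur in
   the sum, Cauchy-Schwarz along the path yields the constant
   sqrt ((L + Delta) / (2 + Delta)). *)
Require Import Defs.
From HB Require Import structures.
From mathcomp Require Import all_boot all_order all_algebra.
From mathcomp Require Import all_classical all_reals all_analysis.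
From mathcomp Require Import complex.
From mathcomp Require Import ring lra zify.
Set Implicit Arguments.
Unset Strict Implicit.
Unset Printing Implicit Defensive.
Import Order.TTheory GRing.Theory Num.Theory.
Local Open Scope classical_set_scope.
Local Open Scope ring_scope.

(* [ring] fails on the conjugates of a [numClosedFieldType] unless they are
   generalized. *)
Ltac conj_ring :=
  repeat match goal with
         | |- context [Num.conj ?t] => generalize (Num.conj t); intro
         end;
  ring.

(** * Fourier analysis on Z/N *)

Section Fourier.
Variables (C : numClosedFieldType) (n : nat) (z : C).
Hypothesis z_prim : n.+1.-primitive_root z.
Local Notation N := n.+1.

Definition chi (a b : 'I_N) : C := z ^+ (a * b).

Lemma chiC a b : chi a b = chi b a.
Proof. by rewrite /chi mulnC. Qed.

Lemma chiDl a a' b : chi (a + a') b = chi a b * chi a' b.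
Proof.
by rewrite /chi exprM prim_expr_mod// -!exprM -exprD mulnDl.
Qed.

Lemma chiDr a b b' : chi a (b + b') = chi a b * chi a b'.
Proof. by rewrite chiC chiDl !(chiC a). Qed.

Lemma chi0l b : chi 0 b = 1.
Proof. by rewrite /chi mul0n expr0. Qed.

Lemma norm_chi a b : `|chi a b| = 1.
Proof.
suff nz : `|z| = 1 by rewrite /chi normrX nz expr1n.
apply/eqP; rewrite -(@pexpr_eq1 _ _ N)//.
by rewrite -normrX prim_expr_order// normr1.
Qed.

Lemma chiNl a b : chi (- a) b = (chi a b)^*.
Proof.
have chi_neq0 : chi a b != 0 by rewrite -normr_eq0 norm_chi oner_neq0.
apply: (mulfI chi_neq0).
by rewrite -chiDl subrr chi0l -normCK norm_chi expr1n.
Qed.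

Lemma sum_chi a : \sum_b chi a b = N%:R * (a == 0)%:R.
Proof.
have [->|a0] := eqVneq a 0.
  under eq_bigr do rewrite chi0l.
  by rewrite sumr_const card_ord mulr1.
(* Shifting [b] by 1 multiplies the sum by [chi a (inZp 1)], which differs from 1 for nonzero [a]
   because [z] is primitive. *)
rewrite mulr0; have : chi a (inZp 1) * \sum_b chi a b = \sum_b chi a b.
  rewrite mulr_sumr [RHS](reindex_inj (addrI (inZp 1))) /=.
  by apply: eq_bigr => b _; rewrite chiDr.
move/eqP; rewrite -subr_eq0 -{2}[\sum_b _]mul1r -mulrBl mulf_eq0 subr_eq0.
case/orP => [|/eqP//].
have n1 : (0 < n)%N by move: a a0; case: n => // a; rewrite ord1.
rewrite /chi /= modn_small// muln1 -(prim_order_dvd z_prim) => /dvdn_leq.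
by move=> H; move: (H ltac:(rewrite lt0n; exact: a0)); rewrite leqNgt ltn_ord.
Qed.

Lemma parseval (f : 'I_N -> C) :
  \sum_b `|\sum_a f a * chi a b| ^+ 2 = N%:R * \sum_a `|f a| ^+ 2.
Proof.
transitivity (\sum_b \sum_a \sum_a' f a * (f a')^* * chi (a - a') b).
  apply: eq_bigr => b _; rewrite normCK rmorph_sum big_distrlr /=.
  apply: eq_bigr => a _; apply: eq_bigr => a' _.
  by rewrite rmorphM /= chiDl chiNl mulrACA.
rewrite exchange_big mulr_sumr; apply: eq_bigr => a _ /=.
rewrite exchange_big /=.
under eq_bigr do rewrite -mulr_sumr sum_chi subr_eq0.
rewrite (bigD1 a)//= eqxx big1 => [|a' ne].
  by rewrite normCK addr0 mulr1 mulrC.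
by rewrite eq_sym (negPf ne) !mulr0.
Qed.

Lemma parseval2 (f : 'I_N -> 'I_N -> C) :
  \sum_p \sum_q `|\sum_m \sum_b f m b * chi b p * chi m q| ^+ 2
  = N%:R ^+ 2 * \sum_m \sum_b `|f m b| ^+ 2.
Proof.
under eq_bigr => p _.
  under eq_bigr => q _.
    under eq_bigr do rewrite -mulr_suml.
    over.
  rewrite parseval; over.
rewrite -mulr_sumr expr2 -mulrA; congr (_ * _).
rewrite exchange_big mulr_sumr; apply: eq_bigr => m _ /=.
exact: parseval.
Qed.

(* The Gabor transform without its factor [1 / sqrt L]. *)
Definition stft (f g : 'I_N -> C) (m b : 'I_N) : C :=
  \sum_l f l * (g (l - m))^* * chi l b.

(** Expanding the square gives a double sum over [l] and [l'], and summation over [b] forces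
    [l' = l + p]. The substitution of [l - m] for [m] then separates the variables into a product of
    two sums. *)
Lemma stft_sqr_fourier f g p q :
  \sum_m \sum_b `|stft f g m b| ^+ 2 * chi b p * chi m q
  = N%:R * (stft f f (- p) q * (stft g g (- p) q)^*).
Proof.
transitivity (\sum_m N%:R * \sum_l f l * (f (l + p))^* * (g (l - m))^* *
    g (l - m + p) * chi m q).
  apply: eq_bigr => m _; rewrite mulr_sumr.
  transitivity (\sum_b \sum_l \sum_l' f l * (f l')^* * (g (l - m))^* *
      g (l' - m) * chi m q * chi (l - l' + p) b).
    apply: eq_bigr => b _; rewrite normCK rmorph_sum big_distrlr /=.
    rewrite !mulr_suml; apply: eq_bigr => l _.
    rewrite !mulr_suml; apply: eq_bigr => l' _.
    by rewrite !rmorphM /= conjCK !chiDl chiNl (chiC b p); conj_ring.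
  rewrite exchange_big; apply: eq_bigr => l _ /=.
  rewrite exchange_big /=.
  under eq_bigr do rewrite -mulr_sumr sum_chi.
  rewrite (bigD1 (l + p))//= opprD addrA subrr add0r addNr eqxx big1 => [|l' ne].
    by rewrite addr0 mulr1 [RHS]mulrC (addrAC l p).
  rewrite (_ : (_ == 0) = false) ?mulr0//; apply: contra_neqF ne => /eqP h.
  by apply/eqP; rewrite eq_sym -subr_eq0 addrAC h.
rewrite -mulr_sumr; congr (_ * _); rewrite exchange_big /stft mulr_suml /=.
apply: eq_bigr => l _.
rewrite rmorph_sum (reindex_inj (inj_comp (addrI l) oppr_inj)) /= mulr_sumr.
apply: eq_bigr => m _; rewrite !rmorphM /= conjCK !opprK !subKr.
by rewrite chiDl chiNl; conj_ring.
Qed.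

(** After multiplication by N^2 the left side is the energy of a two-dimensional Fourier transform,
    which [stft_sqr_fourier] evaluates. Reindexing by the opposite lag absorbs the reflection
    there. *)
Lemma stft_sqr_dist f g h :
  \sum_m \sum_b `| `|stft f h m b| ^+ 2 - `|stft g h m b| ^+ 2 | ^+ 2
  = \sum_m \sum_b `|stft f f m b - stft g g m b| ^+ 2 * `|stft h h m b| ^+ 2.
Proof.
have N0 : N%:R ^+ 2 != 0 :> C by rewrite expf_neq0 // pnatr_eq0.
apply: (mulfI N0); rewrite -parseval2 mulr_sumr (reindex_inj oppr_inj) /=.
apply: eq_bigr => p _; rewrite mulr_sumr; apply: eq_bigr => q _.
under eq_bigr do (under eq_bigr do rewrite !mulrBl; rewrite sumrB).
rewrite sumrB !stft_sqr_fourier opprK -mulrBr -mulrBl normrM normr_nat exprMn.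
by rewrite normrM exprMn norm_conjC.
Qed.

(** Shifting the summation variable by [m] produces the conjugate sum up to a unimodular factor.
    This symmetry carries lower bounds on the window from lags 0, ..., Delta + 1 to their
    negatives. *)
Lemma stft_reflect g m b : `|stft g g (- m) (- b)| = `|stft g g m b|.
Proof.
rewrite -(norm_conjC (stft g g m b)) /stft rmorph_sum /=.
rewrite (reindex_inj (addIr (- m))) /=.
rewrite (_ : \sum_l _ = chi (- m) (- b) *
   \sum_l (g l * (g (l - m))^* * chi l b)^* ).
  rewrite normrM -[RHS]mul1r; congr (_ * _).
  exact: norm_chi.
rewrite mulr_sumr; apply: eq_bigr => l _.
rewrite opprK subrK !rmorphM /= conjCK chiDl (chiC l) chiNl (chiC b).
by conj_ring.
Qed.

Lemma fourier_inversion f l :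
  f l = N%:R^-1 * \sum_k (\sum_a f a * chi a k) * (chi l k)^*.
Proof.
under eq_bigr do rewrite mulr_suml.
rewrite exchange_big /=.
under eq_bigr => a _.
  under eq_bigr do rewrite -mulrA -chiNl -chiDl.
  rewrite -mulr_sumr sum_chi subr_eq0; over.
rewrite (bigD1 l)//= eqxx big1 => [|a ne]; last by rewrite (negPf ne) !mulr0.
by rewrite addr0 mulr1 mulrCA mulVf ?mulr1 ?pnatr_eq0.
Qed.

(** A pointwise product in time is a convolution in frequency: after Fourier inversion of both
    factors, the sum over [l] kills every pair of frequencies with [b] different from [k - k']. *)
Lemma stft_band f m b : stft f f m b != 0 ->
  exists k k', [/\ \sum_a f a * chi a k != 0, \sum_a f a * chi a k' != 0
    & b = k - k'].
Proof.
pose F k := \sum_a f a * chi a k.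
have [/existsP[k /existsP[k' /and3P[Fk Fk' /eqP b_eq]]] _|] := boolP
  [exists k, exists k', [&& F k != 0, F k' != 0 & b == k - k']].
  by exists k, k'.
rewrite negb_exists => /forallP noband.
rewrite (_ : stft f f m b = 0) ?eqxx//.
transitivity (\sum_l \sum_k \sum_k' N%:R ^- 2 * F k * (F k')^* *
   chi (- m) k' * chi (b - k + k') l).
  apply: eq_bigr => l _; rewrite {1}fourier_inversion (fourier_inversion f (l - m)).
  rewrite rmorphM rmorph_sum /= mulrACA big_distrlr /= mulr_sumr mulr_suml.
  apply: eq_bigr => k _; rewrite mulr_sumr mulr_suml; apply: eq_bigr => k' _.
  rewrite rmorphM /= conjCK !chiDl chiNl fmorphV rmorph_nat (chiC b) (chiC k').
  rewrite chiNl -/(F k) -/(F k') (chiC k) expr2 invfM; conj_ring.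
rewrite exchange_big big1// => k _; rewrite exchange_big big1// => k' _ /=.
rewrite -mulr_sumr sum_chi.
have [->|Fk] := eqVneq (F k) 0; first by rewrite !(mulr0, mul0r).
have [->|Fk'] := eqVneq (F k') 0; first by rewrite conjC0 !(mulr0, mul0r).
case: eqP => [e|]; last by rewrite !mulr0.
have := noband k; rewrite negb_exists => /forallP/(_ k').
by rewrite Fk Fk' /= -subr_eq0 opprB [k' - k]addrC addrA e eqxx.
Qed.
End Fourier.

(** * Residues modulo L, and the DFT kernel as powers of a primitive root of unity *)

Lemma residue_congr (L : nat) (l : 'I_L) (z : int) :
  (z = l%:Z %[mod L%:Z])%Z -> residue L z = Some l.
Proof.
move=> zl; rewrite (divz_eq z L%:Z) zl modz_nat modn_small//.
exact: residue_ord.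
Qed.

Lemma subZp_congr n (a b : 'I_n.+1) :
  ((a - b)%R%:Z = a%:Z - b%:Z %[mod n.+1%:Z])%Z.
Proof.
have e : (((a - b)%R + b) %% n.+1)%N = a := congr1 val (subrK b a).
by rewrite -[in RHS]e -modz_nat modzDml PoszD addrK.
Qed.

Lemma expi_add (R : realType) (s t : R) : expi (s + t) = expi s * expi t.
Proof.
rewrite /expi cosD sinD; apply/eqP.
by rewrite eq_complex /= [sin s * _ + _]addrC !eqxx.
Qed.

Lemma expi_natmul (R : realType) (t : R) k : expi (t *+ k) = expi t ^+ k.
Proof.
elim: k => [|k IH]; first by rewrite mulr0n expr0 /expi cos0 sin0.
by rewrite mulrS exprS expi_add IH.
Qed.

Lemma expi_surj (R : realType) (u : R[i]) : modulus u = 1 -> exists t, expi t = u.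
Proof.
case: u => a b /= /eqP; rewrite -[1]sqrtr1 eqr_sqrt// ?addr_ge0 ?sqr_ge0// => /eqP ab.
have a1 : -1 <= a <= 1.
  rewrite -ler_norml -(@expr_le1 _ 2)// -normrX ger0_norm ?sqr_ge0//.
  by rewrite -ab lerDl sqr_ge0.
have sb : sin (acos a) = `|b|.
  by rewrite sin_acos// -ab addrAC subrr add0r sqrtr_sqr.
have ca : cos (acos a) = a by rewrite acosK// in_itv.
have [b0|b0] := leP 0 b; [exists (acos a)|exists (- acos a)]; rewrite /expi.
  by rewrite ca sb ger0_norm.
by rewrite cosN sinN ca sb ltr0_norm// opprK.
Qed.

Definition dft_root (R : realType) n : R[i] := expi (- (2 * pi / n.+1%:R)).

Lemma dft_root_prim (R : realType) n : n.+1.-primitive_root (dft_root R n).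
Proof.
have rootX k : dft_root R n ^+ k = expi (- (pi * (k%:R / n.+1%:R)) *+ 2).
  rewrite /dft_root -expi_natmul; congr (expi _); move: (pi : R) => p.
  rewrite !mulNrn -(mulr_natr (2 * p / _)) -(mulr_natr (p * _)).
  by move: n.+1%:R k%:R => M K; ring.
apply/andP; split=> //; apply/forallP => i; rewrite unity_rootE rootX.
have N0 : n.+1%:R != 0 :> R by rewrite pnatr_eq0.
apply/eqP; have [->|iN] := eqVneq i.+1 n.+1.
  rewrite divff// mulr1 mulNrn /expi cosN sinN cos2pi sin2pi oppr0; exact/eqP.
(* A power equal to 1 would make the squared sine of half its angle vanish, by the double-angle
   formula; but that half angle lies strictly between 0 and pi. *)
apply/negbTE; apply/eqP => /(congr1 (@complex.Re R)) /=.
rewrite cos_mulr2n cosN cos2sin2 => e.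
have : 0 < sin (pi * (i.+1%:R / n.+1%:R) : R).
  apply: sin_gt0_pi; rewrite mulr_gt0 ?pi_gt0 ?divr_gt0 ?ltr0n//=.
  rewrite gtr_pMr ?pi_gt0// ltr_pdivrMr ?ltr0n// mul1r ltr_nat.
  by rewrite ltn_neqAle iN ltn_ord.
move=> /(exprn_gt0 2); move: e; rewrite -mulr_natr; lra.
Qed.

Lemma chi_root (R : realType) n (a b : 'I_n.+1) :
  expi (- (2 * pi * a%:R * b%:R / n.+1%:R)) = chi (dft_root R n) a b.
Proof.
rewrite /chi -expi_natmul; congr (expi _); rewrite -[RHS]mulr_natr natrM.
by move: (pi : R) n.+1%:R => p M; ring.
Qed.

(* The cyclic distance from [m] to [0] is at most [D + 1]. *)
Definition short_lag n (D : nat) (m : 'I_n.+1) :=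
  (m <= D.+1)%N || ((- m)%R <= D.+1)%N.

(** * Energy of the short lags *)

Section LagEnergy.
Variables (R : realType) (n : nat).
Local Notation N := n.+1.
Local Notation vec := ('cV[R[i]]_N).
Local Notation z := (dft_root R n).
Let s : R := (Num.sqrt N%:R)^-1.

Let s_sqr : s ^+ 2 * N%:R = 1.
Proof. by rewrite /s exprVn sqr_sqrtr// mulVf// pnatr_eq0. Qed.

Let s_norm : `|s%:C%C| = s%:C%C.
Proof. by rewrite ger0_norm// ler0c invr_ge0 sqrtr_ge0. Qed.

Lemma dft_chi (x : vec) k : dft x k 0 = s%:C%C * \sum_l x l 0 * chi z l k.
Proof. by rewrite mxE; congr (_ * _); apply: eq_bigr => l _; rewrite chi_root. Qed.

Lemma gabor_stft (phi x : vec) m b :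
  gabor phi x m b = s%:C%C * stft z (fun l => x l 0) (fun l => phi l 0) m b.
Proof.
rewrite mxE; congr (_ * _); apply: eq_bigr => l _; rewrite chi_root /perV.
by rewrite (@residue_congr _ (l - m)) ?subZp_congr.
Qed.

(** Identities between real moduli are proved in [R[i]], through the injectivity of the embedding of
    [R]. *)
Lemma realC_normc (w : R[i]) : (modulus w)%:C%C = `|w|.
Proof. by []. Qed.

Lemma frobenius_measurement (phi x y : vec) :
  frobenius (measurement phi x - measurement phi y) ^+ 2 =
  \sum_m \sum_b modulus (ambiguity x m b - ambiguity y m b) ^+ 2 *
                modulus (ambiguity phi m b) ^+ 2.
Proof.
rewrite /frobenius sqr_sqrtr; last first.
  by apply: sumr_ge0 => i _; apply: sumr_ge0 => j _; apply: sqr_ge0.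
apply: complexI; rewrite !rmorph_sum /=.
under eq_bigr do rewrite rmorph_sum.
under [RHS]eq_bigr do rewrite rmorph_sum.
transitivity (s%:C%C ^+ 4 * \sum_m \sum_b
  `| `|stft z (fun l => x l 0) (fun l => phi l 0) m b| ^+ 2 -
     `|stft z (fun l => y l 0) (fun l => phi l 0) m b| ^+ 2 | ^+ 2).
  rewrite mulr_sumr; apply: eq_bigr => m _; rewrite mulr_sumr; apply: eq_bigr => b _.
  rewrite [in RHS]real_normK; last first.
    by rewrite rpredB// rpredX// normr_real.
  have E w : measurement phi w m b = modulus (gabor phi w m b) ^+ 2 by rewrite mxE.
  rewrite real_normK ?num_real// mxE [X in _ + X]mxE !E rmorphXn rmorphB !rmorphXn /= !realC_normc.
  rewrite !gabor_stft !normrM s_norm.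
  by rewrite !exprMn -mulrBr exprMn -exprM.
rewrite (stft_sqr_dist (dft_root_prim R n)).
rewrite mulr_sumr; apply: eq_bigr => m _; rewrite mulr_sumr; apply: eq_bigr => b _.
rewrite rmorphM !rmorphXn /= !realC_normc !gabor_stft -mulrBr !normrM s_norm.
by rewrite !exprMn [RHS]mulrACA -exprD.
Qed.

(** At a fixed lag [m], the ambiguity function is the unitary DFT of the product of [x] with its
    conjugate translate, so this is Parseval in the frequency variable. *)
Lemma ambiguity_parseval (x y : vec) m :
  \sum_b modulus (ambiguity x m b - ambiguity y m b) ^+ 2 =
  \sum_l modulus (x l 0 * (x (l - m) 0)^* - y l 0 * (y (l - m) 0)^*) ^+ 2.
Proof.
apply: complexI; rewrite !rmorph_sum /=.
transitivity (s%:C%C ^+ 2 * \sum_b `|\sum_l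
   (x l 0 * (x (l - m) 0)^* - y l 0 * (y (l - m) 0)^*) * chi z l b| ^+ 2).
  rewrite mulr_sumr; apply: eq_bigr => b _.
  rewrite rmorphXn /= realC_normc !gabor_stft -mulrBr normrM exprMn; congr (_ * _).
    by rewrite s_norm.
  rewrite /stft -sumrB; congr (`|_| ^+ 2); apply: eq_bigr => l _.
  by rewrite -mulrBl.
rewrite (parseval (dft_root_prim R n)) mulrA.
rewrite (_ : _ * N%:R = 1).
  by rewrite mul1r; apply: eq_bigr => l _; rewrite rmorphXn.
by rewrite -(rmorph_nat (real_complex R)) -rmorphXn -rmorphM s_sqr.
Qed.

Variable B : nat.
Definition inband (k : 'I_N) :=
  exists2 j : int, - B%:Z <= j <= B%:Z & (k%:Z = j %[mod N%:Z])%Z.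

Lemma ambiguity_band (x : vec) m b : bandlimited B x -> ambiguity x m b != 0 ->
  exists k k', [/\ inband k, inband k' & b = k - k'].
Proof.
move=> xB; rewrite gabor_stft mulf_eq0 negb_or => /andP[s0].
move=> /(stft_band (dft_root_prim R n))[k [k' [Fk Fk' bE]]].
by exists k, k'; split => //; apply: xB; rewrite inE dft_chi mulf_neq0.
Qed.

Variables (Delta : nat) (phi : vec) (c : R).
Hypothesis (phi_c : forall m n : int,
     0 <= m <= Delta%:Z + 1 -> - (2 * B%:Z) <= n <= 2 * B%:Z ->
     1 / c <= modulus (perM (ambiguity phi) m n)).

(** The difference of two representatives in -B..B lies in -2B..2B, where [phi_c] applies. If only
    [- m] is at most Delta + 1, reflection exchanges [k] and [k']. *)
Lemma ambiguity_lower m k k' : short_lag Delta m -> inband k -> inband k' ->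
  1 / c <= modulus (ambiguity phi m (k - k')).
Proof.
have main (m' l l' : 'I_N) : (m' <= Delta.+1)%N -> inband l -> inband l' ->
    1 / c <= modulus (ambiguity phi m' (l - l')).
  move=> mD [j jB lj] [j' j'B lj'].
  have := @phi_c m'%:Z (j - j'); rewrite /perM.
  rewrite (@residue_congr _ m') ?(@residue_congr _ (l - l'))//.
    by apply; lia.
  by rewrite subZp_congr -modzDml -modzDmr -modzNm -lj -lj' modzNm modzDmr modzDml.
move=> /orP[|] mD; first exact: main.
move=> kB k'B; have := main _ _ _ mD k'B kB.
rewrite !gabor_stft !Normc.normcM -[k' - k]opprB.
have /complexI -> // := stft_reflect (dft_root_prim R n) (fun l => phi l 0) m (k - k').
Qed.

Hypothesis c_gt0 : 0 < c.

Lemma lag_energy (x y : vec) : bandlimited B x -> bandlimited B y ->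
  \sum_l \sum_(k | short_lag Delta (l - k))
     modulus (x l 0 * (x k 0)^* - y l 0 * (y k 0)^*) ^+ 2 <=
  (c * frobenius (measurement phi x - measurement phi y)) ^+ 2.
Proof.
move=> xB yB.
under eq_bigr => l _.
  rewrite (reindex_inj (inj_comp (addrI l) oppr_inj)) /=.
  under eq_bigl do rewrite subKr.
  over.
rewrite exchange_big /= exprMn frobenius_measurement.
under eq_bigr do rewrite -ambiguity_parseval.
(* The left side is now a sum over short lags only; the remaining lags on the right are nonnegative
   and are dropped. *)
rewrite mulr_sumr [leRHS](bigID (short_lag Delta)) /= -[leLHS]addr0.
have term_ge0 m b : 0 <= modulus (ambiguity x m b - ambiguity y m b) ^+ 2 *
    modulus (ambiguity phi m b) ^+ 2 by rewrite mulr_ge0 ?sqr_ge0.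
apply: lerD; last first.
  apply: sumr_ge0 => m _; rewrite mulr_ge0 ?sqr_ge0//.
  by apply: sumr_ge0 => b _.
apply: ler_sum => m mD; rewrite mulr_sumr; apply: ler_sum => b _.
(* Where the two ambiguity functions agree, both sides vanish. Elsewhere one of them is nonzero, so
   [b] is a difference of in-band frequencies and the window satisfies its lower bound. *)
have [->|xy] := eqVneq (ambiguity x m b - ambiguity y m b) 0.
  by rewrite Normc.normc0 expr0n /= mul0r mulr0.
have [k [k' [kB k'B bE]]] : exists k k', [/\ inband k, inband k' & b = k - k'].
  have [x0|/(ambiguity_band xB)//] := eqVneq (ambiguity x m b) 0.
  by apply: (ambiguity_band yB (m := m)); apply: contraNneq xy => ->; rewrite x0 subrr.
have := ambiguity_lower mD kB k'B; rewrite -bE ler_pdivrMr// => c1.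
rewrite mulrCA ler_peMr ?sqr_ge0// -exprMn mulrC expr_ge1//.
by rewrite (le_trans ler01).
Qed.

End LagEnergy.

(** * Relative phases *)

Section Phase.
Variable C : numClosedFieldType.
Implicit Types (u v t : C).

(** As division by 0 gives 0, [sgC 0] is 0, and multiplicativity and the polar form hold for all
    arguments. *)
Definition sgC u := u / `|u|.

Lemma norm_sgC u : u != 0 -> `|sgC u| = 1.
Proof. by move=> u0; rewrite normrM normfV normr_id divff// normr_eq0. Qed.

Lemma sgCM u v : sgC (u * v) = sgC u * sgC v.
Proof. by rewrite /sgC normrM invfM mulrACA. Qed.

Lemma sgC_conj u : sgC u^* = (sgC u)^*.
Proof. by rewrite /sgC norm_conjC rmorphM fmorphV /= (CrealP (normr_real u)). Qed.

Lemma sgC_polar u : u = `|u| * sgC u.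
Proof.
have [->|u0] := eqVneq u 0; first by rewrite normr0 mul0r.
by rewrite mulrC divfK// normr_eq0.
Qed.

(** Multiplied by [|u|], the difference is [u - v] plus [sgC v] times a difference of moduli, and
    each summand has modulus at most that of [u - v]. *)
Lemma sgC_dist u v : u != 0 -> v != 0 -> `|sgC u - sgC v| <= 2 * `|u - v| / `|u|.
Proof.
move=> u0 v0.
have nu : 0 < `|u| by rewrite normr_gt0.
rewrite ler_pdivlMr// -[X in _ * X](normr_id u) -normrM mulrBl {1}/sgC divfK ?gt_eqF//.
rewrite (_ : _ - _ = (u - v) + sgC v * (`|v| - `|u|)); last first.
  by rewrite mulrBr [sgC v * `|v|]mulrC -sgC_polar addrA subrK.
rewrite (le_trans (ler_normD _ _))// normrM norm_sgC// mul1r mulr_natl mulr2n lerD2l.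
by rewrite distrC; exact: ler_dist_dist.
Qed.

Definition phase u v := sgC u * (sgC v)^*.

Lemma norm_phase u v : u != 0 -> v != 0 -> `|phase u v| = 1.
Proof. by move=> u0 v0; rewrite normrM norm_conjC !norm_sgC// mul1r. Qed.

Lemma sgC_mul_conj u : u != 0 -> sgC u * (sgC u)^* = 1.
Proof. by move=> u0; rewrite -normCK norm_sgC// expr1n. Qed.

(** A unimodular factor turns the difference of the two relative phases into the difference of the
    signs of [u * u'^*] and [v * v'^*], to which [sgC_dist] applies. *)
Lemma phase_dist u u' v v' : u != 0 -> u' != 0 -> v != 0 -> v' != 0 ->
  `|phase u v - phase u' v'| <= 2 * `|u * u'^* - v * v'^*| / (`|u| * `|u'|).
Proof.
move=> u0 u'0 v0 v'0.
have := @sgC_dist (u * u'^*) (v * v'^*).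
rewrite !mulf_neq0 ?conjC_eq0// => /(_ isT isT).
rewrite normrM norm_conjC; apply: le_trans.
rewrite !sgCM !sgC_conj.
rewrite (_ : sgC u * (sgC u')^* - _ = (phase u v - phase u' v') * ((sgC u')^* * sgC v)).
  by rewrite normrM (normrM (sgC u')^*) norm_conjC !norm_sgC// !mulr1.
have := sgC_mul_conj u'0; have := sgC_mul_conj v0; rewrite /phase.
move: (sgC u) (sgC u') (sgC v) (sgC v)^* (sgC u')^* (sgC v')^* => a b d e f g.
move=> de bf; rewrite mulrBl.
have -> : a * e * (f * d) = a * f * (d * e) by ring.
have -> : b * g * (f * d) = d * g * (b * f) by ring.
by rewrite de bf !mulr1.
Qed.

(** The error splits into one of moduli and one of directions. The former is the difference of
    squared moduli divided by their sum, which is at least [delta]. *)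
Lemma phase_approx (delta : C) u v t : 0 < delta -> delta <= `|u| -> v != 0 -> `|t| = 1 ->
  `|u - t * v| <= `|u * u^* - v * v^*| / delta + `|u| * `|phase u v - t|.
Proof.
move=> d0 du v0 t1.
have u0 : u != 0 by rewrite -normr_gt0 (lt_le_trans d0).
rewrite (_ : u - t * v = (`|u| - `|v|) * (t * sgC v) + `|u| * (sgC u - t * sgC v)).
  rewrite (le_trans (ler_normD _ _))// lerD//.
    rewrite normrM (normrM t) t1 norm_sgC// !mulr1 ler_pdivlMr//.
    rewrite -!normCK subr_sqr normrM ler_wpM2l//.
    by rewrite [leRHS]ger0_norm ?addr_ge0// (le_trans du)// lerDl.
  rewrite normrM normr_id ler_wpM2l//.
  rewrite -[leRHS]mulr1 -(norm_sgC v0) -normrM mulrBl /phase -mulrA [_^* * _]mulrC.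
  by rewrite sgC_mul_conj// mulr1.
rewrite {1}(sgC_polar u) {1}(sgC_polar v); ring.
Qed.
End Phase.

(** * Cauchy-Schwarz and Minkowski inequalities for finite sums *)

Section Sums.
Variable R : rcfType.

Lemma cauchy_schwarz_sum I (r : seq I) (P : pred I) (a b : I -> R) :
  (\sum_(i <- r | P i) a i * b i) ^+ 2 <=
  (\sum_(i <- r | P i) a i ^+ 2) * \sum_(i <- r | P i) b i ^+ 2.
Proof.
set S := \sum_(i <- r | P i) _; set A := \sum_(i <- r | P i) a i ^+ 2.
set B := \sum_(i <- r | P i) _.
have quad t s : 0 <= A * t ^+ 2 - 2 * S * (t * s) + B * s ^+ 2.
  rewrite (_ : _ + _ = \sum_(i <- r | P i) (a i * t - b i * s) ^+ 2).
    by apply: sumr_ge0 => i _; apply: sqr_ge0.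
  rewrite /A /S /B !mulr_suml mulr_sumr mulr_suml -sumrB -big_split /=.
  by apply: eq_bigr => i _; ring.
have B0 : 0 <= B by apply: sumr_ge0 => i _; apply: sqr_ge0.
(* For [B = 0] the chosen arguments reduce the form to [- S ^+ 2], so [S] vanishes; for [B > 0] the
   arguments [B] and [S] give [B] times [A * B - S ^+ 2]. *)
have [Bp|Bn|Bz] := ltgtP 0 B; last 1 first.
- have := quad S ((A + 1) / 2); rewrite -Bz mul0r addr0 mulr0.
  by rewrite (_ : _ - _ = - S ^+ 2) ?oppr_ge0//; field.
- have := quad B S; rewrite (_ : _ + _ = B * (A * B - S ^+ 2)); last by ring.
  by rewrite pmulr_rge0// subr_ge0.
- by move: Bn; rewrite ltNge B0.
Qed.

Lemma sqr_sum_le I (r : seq I) (a : I -> R) :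
  (\sum_(i <- r) a i) ^+ 2 <= (size r)%:R * \sum_(i <- r) a i ^+ 2.
Proof.
have := cauchy_schwarz_sum r xpredT a (fun=> 1).
under eq_bigr do rewrite mulr1.
by rewrite mulrC big_const_seq count_predT iter_addr_0 expr1n.
Qed.

Lemma minkowski_sum I (r : seq I) (P : pred I) (a b : I -> R) :
  Num.sqrt (\sum_(i <- r | P i) (a i + b i) ^+ 2) <=
  Num.sqrt (\sum_(i <- r | P i) a i ^+ 2) + Num.sqrt (\sum_(i <- r | P i) b i ^+ 2).
Proof.
have ge0 f : 0 <= \sum_(i <- r | P i) f i ^+ 2 :> R.
  by apply: sumr_ge0 => i _; apply: sqr_ge0.
rewrite -(@ler_pXn2r _ 2)// ?nnegrE ?addr_ge0 ?sqrtr_ge0//.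
rewrite sqrrD !sqr_sqrtr//.
under eq_bigr do rewrite sqrrD.
rewrite !big_split /= -mulr2n lerD2r lerD2l lerMn2r /=.
rewrite -sqrtrM// (le_trans (ler_norm _))// -sqrtr_sqr ler_wsqrtr//.
exact: cauchy_schwarz_sum.
Qed.
End Sums.

(** * Paths in the essential support graph *)

Section Paths.
Variable T : finType.

Lemma chordless_path (e : rel T) x y : connect e x y ->
  exists p, [/\ path e x p, last x p = y, uniq (x :: p) &
    forall i j, (i.+1 < j <= size p)%N ->
      ~~ e (nth x (x :: p) i) (nth x (x :: p) j)].
Proof.
pose P d := [exists p : d.-tuple T,
  [&& path e x p, last x p == y & uniq (x :: p)]].
move=> /connectP[p0 xp0 yE].
have exP : exists d, P d.
  move: yE; have [p' xp' up' _] := shortenP xp0 => yE; exists (size p').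
  by apply/existsP; exists (in_tuple p'); rewrite /= xp' -yE eqxx; exact: up'.
have [d /existsP[p /and3P[xp /eqP py up]] dmin] := ex_minnP exP.
exists p; split=> // i j /andP[ij jp]; apply/negP => eij.
have last_take k : (k <= size p)%N -> last x (take k p) = nth x (x :: p) k.
  move=> kp; rewrite (last_nth x) size_takel//.
  by case: k kp => //= k kp; rewrite nth_take.
have j0 : (0 < j)%N by exact: leq_ltn_trans ij.
(* The shortcut along the chord skips the vertices i + 1, ..., j - 1. Vertex j of [x :: p] has index
   j - 1 in [p]. *)
pose q := take i p ++ drop j.-1 p.
have dropE : drop j.-1 p = nth x (x :: p) j :: drop j p.
  by rewrite (drop_nth x) ?prednK//; case: (j) j0.
have qsz : (size q < d)%N.
  rewrite size_cat size_drop size_take size_tuple.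
  by move: ij jp; rewrite size_tuple; case: ifP; lia.
have : P (size q).
  apply/existsP; exists (in_tuple q); apply/and3P; split.
  - rewrite /= cat_path take_path//= dropE /= last_take ?eij /=; last by lia.
    by move: xp; rewrite -[X in path _ _ X -> _](cat_take_drop j p) cat_path last_take// => /andP[].
  - rewrite /= last_cat dropE /= -py -[X in _ == last x X](cat_take_drop j p) last_cat.
    by rewrite last_take.
  - apply: (subseq_uniq _ up) => /=; rewrite eqxx /q.
    rewrite -[X in subseq _ X](cat_take_drop i p).
    apply: cat_subseq => //; rewrite (_ : j.-1 = (j.-1 - i) + i)%N; last by lia.
    by rewrite -drop_drop; exact: drop_subseq.
by move=> /dmin; rewrite leqNgt qsz.
Qed.

Lemma pairmap_triangle (R : realType) (e : rel T) (u : T -> R[i]) (g : T -> T -> R) r p :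
  path e r p -> (forall a b, e a b -> modulus (u a - u b) <= g a b) ->
  modulus (u (last r p) - u r) <= \sum_(t <- pairmap g r p) t.
Proof.
move=> + eg; elim: p r => [|a p IH] r /=; first by rewrite big_nil subrr Normc.normc0.
move=> /andP[ra /IH{}IH]; rewrite big_cons.
rewrite (_ : _ - _ = (u (last a p) - u a) + (u a - u r)); last by rewrite addrA subrK.
rewrite (le_trans (le_normcD _ _))// addrC lerD//.
by rewrite -normcN opprB eg.
Qed.

(* Each edge of the path is counted in both orientations on the right. *)
Lemma pairmap_sum_le (R : realFieldType) (f : T -> T -> R) r p :
  (forall a b, 0 <= f a b) -> (forall a b, f a b = f b a) -> uniq (r :: p) ->
  2 * \sum_(t <- pairmap f r p) t <= \sum_a \sum_b f a b.
Proof.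
move=> f0 fC up; have sub (g : T -> R) s : (forall a, 0 <= g a) -> uniq s ->
    \sum_(a <- s) g a <= \sum_a g a.
  move=> g0 us; rewrite big_uniq//= [leRHS](bigID (mem s)) /= lerDl.
  by apply: sumr_ge0.
have g0 (s : seq T) a : 0 <= \sum_(b <- s) f a b by apply: sumr_ge0.
apply: (@le_trans _ _ (\sum_(a <- r :: p) \sum_(b <- r :: p) f a b)); last first.
  apply: (le_trans (sub _ _ (g0 _) up)); apply: ler_sum => a _.
  exact: sub.
move: up; elim: p r => [|a p IH] r.
  by rewrite /= big_nil mulr0 => _; apply: sumr_ge0 => a _; apply: g0.
move=> /= /andP[_ /IH{}IH].
rewrite big_cons mulrDr big_cons.
rewrite [X in _ <= X + _]big_cons.
under [X in _ <= _ + X]eq_bigr do rewrite big_cons.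
rewrite big_split /=.
under [X in _ <= _ + (X + _)]eq_bigr do rewrite fC.
have : f r a <= \sum_(b <- a :: p) f r b.
  by rewrite big_cons lerDl; apply: sumr_ge0.
move: (f0 r r) IH; lra.
Qed.
End Paths.

(** * Separated points on the cycle and the length of chordless paths *)

Section CyclicLags.
Variables (n D : nat).
Local Notation N := n.+1.

Lemma short_lagN (m : 'I_N) : short_lag D (- m) = short_lag D m.
Proof. by rewrite /short_lag opprK orbC. Qed.

Lemma val_subZp (l k : 'I_N) :
  ((l - k)%R : nat) = (if k <= l then l - k else N + l - k)%N.
Proof.
rewrite /= modnDmr; have [kl|kl] := leqP k l.
  rewrite addnBA ?(ltnW (ltn_ord k))// addnC -addnBA// modnDl modn_small//.
  by have := ltn_ord l; lia.
by rewrite modn_small; have := ltn_ord l; have := ltn_ord k; lia.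
Qed.

(** If two arcs of D + 2 points meet, their starting points differ by a difference of two offsets,
    which is a short lag. *)
Lemma inZp_short_lag_inj (f f' : 'I_N) (j j' : nat) : (D.+2 <= N)%N ->
  (j <= D.+1)%N -> (j' <= D.+1)%N -> f + inZp j = f' + inZp j' :> 'I_N ->
  short_lag D (f - f') /\ (f = f' -> j = j').
Proof.
move=> DN jD j'D e; split; last first.
  by move=> ff; move: e; rewrite ff => /addrI /(congr1 val) /=; rewrite !modn_small// (leq_trans _ DN).
wlog jj : f f' j j' jD j'D e / (j <= j')%N => [th|].
  have [|/ltnW] := leqP j j'; first exact: th.
  by rewrite -short_lagN opprB; apply: th.
rewrite (_ : f - f' = inZp j' - inZp j); last first.
  by apply/eqP; rewrite subr_eq addrAC eq_sym subr_eq e addrC.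
have val_inZp k : (k <= D.+1)%N -> nat_of_ord (inZp k : 'I_N) = k.
  by move=> kD; rewrite /= modn_small// (leq_trans _ DN).
by rewrite /short_lag val_subZp !val_inZp// jj (leq_trans (leq_subr _ _)).
Qed.

(* The arcs [f i, ..., f i + D + 1] are pairwise disjoint. *)
Lemma separated_card a (f : 'I_a -> 'I_N) : (D.+2 <= N)%N ->
  (forall i i', i != i' -> ~~ short_lag D (f i - f i')) -> (a * D.+2 <= N)%N.
Proof.
move=> DN sep.
pose g (ij : 'I_a * 'I_D.+2) : 'I_N := f ij.1 + inZp ij.2.
have /leq_card : injective g.
  move=> [i j] [i' j']; rewrite /g /= => e.
  have jD (k : 'I_D.+2) : (k <= D.+1)%N by rewrite -ltnS.
  have [nr jj] := inZp_short_lag_inj DN (jD j) (jD j') e.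
  have [ii|/sep] := eqVneq i i'; last by rewrite nr.
  by rewrite ii; congr (_, _); apply/val_inj/jj; rewrite ii.
by rewrite card_prod !card_ord.
Qed.

(** The summand [D] accommodates a single edge, where N may be smaller than D + 2. On a longer path,
    vertices 0 and 2 are separated, which forces D + 2 <= N and allows the even-numbered vertices to
    be counted by disjoint arcs. *)
Lemma chordless_size (r : 'I_N) p :
  (forall i j, (i.+1 < j <= size p)%N ->
     ~~ short_lag D (nth r (r :: p) i - nth r (r :: p) j)) ->
  (size p * D.+2 <= 2 * (N + D))%N.
Proof.
move=> chord; case: (leqP (size p) 1) => [|p2]; first by case: (size p) => [|[|]]//; lia.
have DN : (D.+2 <= N)%N.
  have := chord 0%N 2%N; rewrite p2 => /(_ isT); rewrite negb_or -ltnNge => /andP[h _].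
  by apply: leq_trans h (ltnW (ltn_ord _)).
suff : ((size p)./2.+1 * D.+2 <= N)%N by have := odd_double_half (size p); nia.
apply: (@separated_card _ (fun i => nth r (r :: p) i.*2)) => // i i' ii.
wlog ltii : i i' ii / (i < i')%N => [th|].
  have [lt|lt|/val_inj eq] := ltngtP i i'; first exact: th.
    by rewrite -short_lagN opprB th// eq_sym.
  by rewrite eq eqxx in ii.
apply: chord; have := ltn_ord i'; have := odd_double_half (size p).
by move: ltii; rewrite -!muln2; lia.
Qed.

End CyclicLags.

(** The two intervals in the edge relation correspond to the two ways around the cycle. Distinctness
    matters because lag 0 is always short, while a loop need not be an edge. *)
Lemma ess_edgeE (R : realType) n (D : nat) (delta : R) (x : 'cV[R[i]]_n.+1) l k :
  l != k ->
  ess_edge D delta x l k =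
  [&& l \in ess_supp delta x, k \in ess_supp delta x & short_lag D (l - k)].
Proof.
move=> lk; rewrite /ess_edge /=; congr [&& _, _ & _].
have {lk} lk : nat_of_ord l != nat_of_ord k by [].
rewrite /short_lag opprB !val_subZp; have := ltn_ord l; have := ltn_ord k.
case: (leqP k l) => kl.
  rewrite ger0_norm; last by rewrite subr_ge0 lez_nat.
  by case: (leqP l k) => ?; lia.
rewrite ler0_norm; last by rewrite subr_le0 lez_nat ltnW.
by rewrite (ltnW kl); lia.
Qed.

(** * Phase estimates for the real-valued modulus *)

Lemma normc_ge0 (R : realType) (w : R[i]) : 0 <= modulus w.
Proof. by case: w => a b; apply: sqrtr_ge0. Qed.

Section PhaseReal.
Variables (R : realType) (delta : R).
Hypothesis delta_gt0 : 0 < delta.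
Implicit Types u v t : R[i].

Lemma normc_neq0 u : delta <= modulus u -> u != 0.
Proof.
move=> du; apply: contraTneq du => ->.
by rewrite Normc.normc0 -ltNge.
Qed.

Lemma normc_phase u v : u != 0 -> v != 0 -> modulus (phase u v) = 1.
Proof. by move=> u0 v0; apply: complexI; exact: norm_phase. Qed.

Lemma phase_dist_normc u u' v v' : delta <= modulus u -> delta <= modulus u' ->
  v != 0 -> v' != 0 ->
  modulus (phase u v - phase u' v') <= 2 / delta ^+ 2 * modulus (u * u'^* - v * v'^*).
Proof.
move=> du du' v0 v'0.
have := phase_dist (normc_neq0 du) (normc_neq0 du') v0 v'0.
rewrite -!realC_normc -(rmorph_nat (real_complex R) 2) -!rmorphM -fmorphV -rmorphM lecR.
move=> /le_trans; apply.
rewrite mulrAC ler_wpM2r ?normc_ge0//.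
rewrite ler_pM2l// lef_pV2 ?posrE ?exprn_gt0 ?mulr_gt0 ?(lt_le_trans delta_gt0)//.
by rewrite expr2 ler_pM// ltW.
Qed.

Lemma phase_approx_normc u v t : delta <= modulus u -> v != 0 -> modulus t = 1 ->
  modulus (u - t * v) <=
  modulus (u * u^* - v * v^*) / delta + modulus u * modulus (phase u v - t).
Proof.
move=> du v0 t1.
have := @phase_approx R[i] delta%:C%C u v t.
rewrite ltcR -!realC_normc lecR t1 -fmorphV -!rmorphM -rmorphD lecR.
exact.
Qed.
End PhaseReal.

(** * Phase recovery on the components *)

Section PhaseRecovery.
Variables (R : realType) (n Delta : nat) (delta : R).
Hypothesis delta_gt0 : 0 < delta.
Local Notation N := n.+1.
Variables (x y : 'cV[R[i]]_N) (eps : R).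
Hypothesis eps_ge0 : 0 <= eps.
Let dxy l k := modulus (x l 0 * (x k 0)^* - y l 0 * (y k 0)^*).
Hypothesis energy : \sum_l \sum_(k | short_lag Delta (l - k)) dxy l k ^+ 2 <= eps ^+ 2.
Let S := (ess_supp delta x :&: supp y)%SET.
Let u l := phase (x l 0) (y l 0).
Let e := Defs.induced (ess_edge Delta delta x) S.

Lemma mem_S l : l \in S -> delta <= modulus (x l 0) /\ y l 0 != 0.
Proof. by rewrite !inE => /andP[]. Qed.

Lemma dxyC l k : dxy l k = dxy k l.
Proof.
apply: complexI; rewrite /dxy !realC_normc -norm_conjC rmorphB !rmorphM /= !conjCK.
by rewrite mulrC [y k 0 * _]mulrC.
Qed.

Lemma diag_energy : \sum_l dxy l l ^+ 2 <= eps ^+ 2.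
Proof.
apply: le_trans energy; apply: ler_sum => l _.
rewrite (bigD1 l) ?subrr//= lerDl; apply: sumr_ge0 => k _; exact: sqr_ge0.
Qed.

Lemma phase_connect r l : connect e r l ->
  modulus (u l - u r) <=
  2 / delta ^+ 2 * (Num.sqrt ((N + Delta)%:R / (2 + Delta)%:R) * eps).
Proof.
move=> /chordless_path[p [rp <- up chord]].
(* Each vertex of a nonempty path is an endpoint of an induced edge, hence in [S]; an empty path
   says nothing about [r]. *)
have Spath i : (0 < size p)%N -> (i <= size p)%N -> nth r (r :: p) i \in S.
  move/(pathP r): rp => rp p0; rewrite leq_eqVlt => /orP[/eqP->|/rp/and3P[]//].
  rewrite (_ : nth r (r :: p) (size p) = nth r p (size p).-1); last first.
    by rewrite -[X in nth r (r :: p) X](prednK p0).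
  by have /rp/and3P[] : ((size p).-1 < size p)%N by rewrite prednK.
have psz : (size p * Delta.+2 <= 2 * (N + Delta))%N.
  apply: (@chordless_size _ _ r) => i j ij; apply: contra (chord i j ij) => nij.
  case/andP: (ij) => lt_ij jp.
  have p0 : (0 < size p)%N.
    by apply: leq_trans jp; exact: leq_ltn_trans lt_ij.
  have iS := Spath i p0 (ltnW (ltnW (leq_trans lt_ij jp))); have jS := Spath j p0 jp.
  rewrite /e /Defs.induced /= iS jS /= ess_edgeE ?nij; last first.
    by rewrite nth_uniq//=; lia.
  by move: iS jS; rewrite !finset.in_setI => /andP[-> _] /andP[-> _].
(* The cutoff lets the sum run over all pairs, as in [pairmap_sum_le], while its energy stays that
   of the short lags. *)
pose h a b := (short_lag Delta (a - b))%:R * dxy a b.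
have hC a b : h a b = h b a by rewrite /h dxyC -short_lagN opprB.
have pairmap_ge0 t : t \in pairmap h r p -> 0 <= t.
  elim: (p) (r) => //= a q IH b; rewrite inE => /orP[/eqP->|/IH//].
  by rewrite mulr_ge0// normc_ge0.
have h2 : \sum_a \sum_b h a b ^+ 2 <= eps ^+ 2.
  apply: le_trans energy; apply: ler_sum => a _; rewrite [leRHS]big_mkcond /=.
  by apply: ler_sum => b _; rewrite /h; case: ifP => _; rewrite ?mul1r// mul0r expr0n.
have := @pairmap_triangle _ _ e u (fun a b => 2 / delta ^+ 2 * h a b) r p rp.
have ge02 : 0 <= 2 / delta ^+ 2 :> R by rewrite divr_ge0// sqr_ge0.
have edge a b : e a b -> modulus (u a - u b) <= 2 / delta ^+ 2 * h a b.
  have [->|ab] := eqVneq a b.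
    rewrite subrr Normc.normc0 => _.
    by rewrite mulr_ge0// /h mulr_ge0// normc_ge0.
  rewrite /e /Defs.induced /= ess_edgeE// => /and3P[/mem_S[xa ya] /mem_S[xb yb] /and3P[_ _ nab]].
  by rewrite /h nab mul1r; exact: phase_dist_normc.
move=> /(_ edge)/le_trans; apply.
rewrite (_ : pairmap _ r p = [seq 2 / delta ^+ 2 * t | t <- pairmap h r p]); last first.
  by elim: (p) (r) => //= a q IH b; rewrite IH.
rewrite big_map -mulr_sumr ler_wpM2l//.
rewrite -(@ler_pXn2r _ 2)// ?nnegrE; first last.
- by rewrite mulr_ge0// sqrtr_ge0.
- by rewrite big_seq; apply: sumr_ge0 => t; exact: pairmap_ge0.
apply: (le_trans (sqr_sum_le _ _)).
have := @pairmap_sum_le _ _ (fun a b => h a b ^+ 2) r p (fun a b => sqr_ge0 _).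
rewrite (_ : pairmap _ r p = [seq t ^+ 2 | t <- pairmap h r p]); last first.
  by elim: (p) (r) => //= a q IH b; rewrite IH.
rewrite big_map => /(_ _ up) hp.
have {hp} := le_trans (hp (fun a b => congr1 (fun t => t ^+ 2) (hC a b))) h2.
rewrite size_pairmap exprMn sqr_sqrtr ?divr_ge0// => hp.
rewrite mulrAC ler_pdivlMr ?ltr0n//.
set Q := \sum_(t <- _) _ in hp *.
have Q0 : 0 <= Q by apply: sumr_ge0 => t _; exact: sqr_ge0.
(* The factor 2 in this length bound cancels the one in [2 * Q <= eps ^+ 2], which comes from
   counting both orientations of each edge. *)
have : (size p)%:R * (2 + Delta)%:R <= 2 * (N + Delta)%:R :> R.
  by rewrite -!natrM ler_nat.
move: psz => _; set M := (N + Delta)%:R; have M0 : 0 <= M :> R by [].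
move: (_%:R) (_%:R) => d D2 dD.
rewrite mulrAC (le_trans (ler_wpM2r Q0 dD))// -mulrA mulrCA ler_wpM2l//.
Qed.

Lemma component_bound l r : l \in S -> r \in S -> connect e r l ->
  modulus (x l 0 - u r * y l 0) <= dxy l l / delta +
  2 / delta ^+ 2 * (Num.sqrt ((N + Delta)%:R / (2 + Delta)%:R) * eps) * modulus (x l 0).
Proof.
move=> /mem_S[xl yl] /mem_S[xr yr] rl.
apply: (le_trans (phase_approx_normc delta_gt0 xl yl (normc_phase (normc_neq0 delta_gt0 xr) yr))).
by rewrite lerD2l mulrC ler_wpM2r ?normc_ge0// phase_connect.
Qed.

Lemma induced_sym : symmetric e.
Proof.
move=> a b; rewrite /e /Defs.induced /ess_edge /= distrC.
by rewrite [RHS]andbCA; congr [&& _, _ & _]; rewrite andbCA.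
Qed.

Lemma exists_phases K (Sk : 'I_K -> {set 'I_N}) : injective Sk ->
  [set Sk k | k : 'I_K]%SET = components (ess_edge Delta delta x) S ->
  exists alpha : 'I_K -> R,
  \sum_(k < K) l2norm (Sk k) (x - expi (alpha k) *: y) <=
  Num.sqrt K%:R / delta *
     (1 + 2 * Num.sqrt ((N + Delta)%:R / (2 + Delta)%:R) *
          (l2norm S x / delta)) * eps.
Proof.
move=> Sk_inj SkE.
have comp k : exists r, r \in S /\ forall l, (l \in Sk k) = (l \in S) && connect e r l.
  have : Sk k \in components (ess_edge Delta delta x) S by rewrite -SkE imset_f.
  by case/imsetP => r rS ->; exists r; split=> // l; rewrite inE.
(* The angle for a component is the argument of the relative phase at one chosen vertex [r] of
   it. *)
have alphaP k : exists t, forall l, l \in Sk k ->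
  modulus (x l 0 - expi t * y l 0) <= dxy l l / delta +
  2 / delta ^+ 2 * (Num.sqrt ((N + Delta)%:R / (2 + Delta)%:R) * eps) * modulus (x l 0).
  have [r [rS rE]] := comp k; have [xr yr] := mem_S rS.
  have [t ut] := expi_surj (normc_phase (normc_neq0 delta_gt0 xr) yr).
  by exists t => l; rewrite rE ut => /andP[lS rl]; apply: component_bound.
have /choice[alpha alphaE] := alphaP; exists alpha.
have sumS (f : 'I_N -> R) : \sum_k \sum_(l in Sk k) f l = \sum_(l in S) f l.
  have partS : finset.partition (components (ess_edge Delta delta x) S) S.
    apply: equivalence_partitionP => a b c _ _ _; split; first exact: connect0.
    by move=> ab; apply: (same_connect (sym_connect_sym induced_sym)).
  by rewrite (set_partition_big _ partS) -SkE big_imset//=; exact: in2W.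
pose q := Num.sqrt ((N + Delta)%:R / (2 + Delta)%:R) : R.
pose b l := 2 / delta ^+ 2 * (q * eps) * modulus (x l 0).
have q0 : 0 <= 2 / delta ^+ 2 * (q * eps).
  by rewrite !mulr_ge0 ?invr_ge0 ?sqr_ge0 ?sqrtr_ge0.
have l2_sum k : l2norm (Sk k) (x - expi (alpha k) *: y) ^+ 2 <=
    \sum_(l in Sk k) (dxy l l / delta + b l) ^+ 2.
  rewrite sqr_sqrtr; last by apply: sumr_ge0 => l _; exact: sqr_ge0.
  apply: ler_sum => l lk; rewrite ler_pXn2r ?nnegrE ?normc_ge0 ?addr_ge0//.
  - by rewrite !mxE; exact: alphaE.
  - by rewrite divr_ge0 ?normc_ge0// ltW.
  - by rewrite mulr_ge0 ?normc_ge0.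
(* Cauchy-Schwarz against the constant 1 yields the factor [Num.sqrt K%:R] and merges the components
   into a single sum over [S]. *)
have := cauchy_schwarz_sum (index_enum 'I_K) xpredT
  (fun k => l2norm (Sk k) (x - expi (alpha k) *: y)) (fun=> 1).
under eq_bigr do rewrite mulr1.
rewrite expr1n sumr_const card_ord mulrC => /le_trans.
move=> /(_ _ (ler_wpM2l (ler0n _ _) (ler_sum _ (fun k _ => l2_sum k)))).
rewrite sumS => /ler_wsqrtr; rewrite sqrtr_sqr => /(le_trans (ler_norm _)).
move=> /le_trans; apply; rewrite sqrtrM ?ler0n// -!mulrA ler_wpM2l ?sqrtr_ge0//.
apply: (le_trans (minkowski_sum _ _ _ _)).
(* The modulus errors, bounded by the diagonal energy, give the summand 1; the phase errors,
   weighted by the modulus of [x], give the summand with [l2norm S x]. *)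
rewrite mulrDl mulrDr lerD//.
  have de0 : 0 <= delta^-1 * eps by rewrite mulr_ge0 ?invr_ge0// ltW.
  rewrite mul1r -(ger0_norm de0) -sqrtr_sqr ler_wsqrtr//.
  under eq_bigr do rewrite expr_div_n mulrC.
  rewrite -mulr_sumr exprMn exprVn ler_wpM2l ?invr_ge0 ?sqr_ge0//.
  apply: le_trans diag_energy; rewrite [leRHS](bigID (mem S)) /= lerDl.
  by apply: sumr_ge0 => l _; exact: sqr_ge0.
rewrite /b; under eq_bigr do rewrite exprMn.
rewrite -mulr_sumr sqrtrM ?sqr_ge0// sqrtr_sqr ger0_norm// -/(l2norm S x) -/q.
move: (l2norm S x) => X; rewrite le_eqVlt; apply/orP; left; apply/eqP.
by field; rewrite gt_eqF.
Qed.
End PhaseRecovery.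

Theorem theorem3p11 (R : realType) (L : nat) (L_gt0 : (0 < L)%N)
  (Delta : nat) (delta : R) (delta_gt0 : 0 < delta)
  (B : nat) (x y : 'cV[R[i]]_L)
  (x_bl : bandlimited B x) (y_bl : bandlimited B y)
  (K : nat) (S : 'I_K -> {set 'I_L}) (S_inj : injective S)
  (S_comp : [set S k | k : 'I_K]%SET =
     components (ess_edge Delta delta x) (ess_supp delta x :&: supp y)%SET)
  (phi : 'cV[R[i]]_L) (c : R) (c_gt0 : 0 < c)
  (phi_c : forall m n : int,
     0 <= m <= Delta%:Z + 1 -> - (2 * B%:Z) <= n <= 2 * B%:Z ->
     1 / c <= modulus (perM (ambiguity phi) m n)) :
  inf [set \sum_(k < K) l2norm (S k) (x - expi (alpha k) *: y)
      | alpha in [set: 'I_K -> R]]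
  <= c * Num.sqrt K%:R / delta *
     (1 + 2 * Num.sqrt ((L + Delta)%:R / (2 + Delta)%:R) *
          (l2norm (ess_supp delta x :&: supp y)%SET x / delta)) *
     frobenius (measurement phi x - measurement phi y).
Proof.
case: L L_gt0 x y x_bl y_bl S S_inj S_comp phi phi_c => // n _ x y x_bl y_bl
  S S_inj S_comp phi phi_c.
set eps := c * frobenius (measurement phi x - measurement phi y).
have eps_ge0 : 0 <= eps by rewrite mulr_ge0 ?sqrtr_ge0 ?ltW.
have [alpha alphaP] := exists_phases delta_gt0 eps_ge0
  (lag_energy phi_c c_gt0 x_bl y_bl) S_inj S_comp.
apply: (@le_trans _ _ (\sum_(k < K) l2norm (S k) (x - expi (alpha k) *: y))).
  (* The infimum lies below each value because the set is bounded below by 0. *)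
  apply: ge_inf; last by exists alpha.
  by exists 0 => _ [a _ <-]; apply: sumr_ge0 => k _; exact: sqrtr_ge0.
apply: (le_trans alphaP); rewrite le_eqVlt; apply/orP; left; apply/eqP.
by rewrite /eps -!mulrA !(mulrCA c).
Qed.
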